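(* Let $(G,G^+)$ be a simple partially ordered abelian group of rank one which is not a Riesz group. Then there exist a simple Riesz group of rank one $(H,H^+)$ and an order-embedding $G\to H$ if and only if $G$ is not isomorphic (as an abelian group) to $\mathbb{Q}$.
   Context: Partially ordered abelian group $(G,G^+)$: abelian group with submonoid $G^+\ni0$, $G^+\cap(-G^+)=\{0\}$, $x\le y$ iff $y-x\in G^+$. Simple: $G\neq0$ and every nonzero $u\in G^+$ is an order-unit (for every $x$ there is $n$ with $-nu\le x\le nu$). Riesz group: whenever $x\le y_1+y_2$ with $x,y_1,y_2\in G^+$ there exist $x_1,x_2\in G^+$ with $x=x_1+x_2$ and $x_j\le y_j$. Rank one: isomorphic to a nonzero subgroup of $\mathbb{Q}$. Order-embedding: injective homomorphism $f$ with $f(G^+)=f(G)\cap H^+$. *)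

(* Defs.v *)
From HB Require Import structures.
From mathcomp Require Import all_boot all_order all_algebra.
Set Implicit Arguments. Unset Strict Implicit. Unset Printing Implicit Defensive.
Import GRing.Theory Num.Theory.
Local Open Scope ring_scope.

Definition is_poag (G : zmodType) (P : G -> Prop) : Prop :=
  [/\ P 0,
      (forall x y, P x -> P y -> P (x + y)) &
      (forall x, P x -> P (- x) -> x = 0)].

Definition ple (G : zmodType) (P : G -> Prop) (x y : G) : Prop := P (y - x).

Definition order_unit (G : zmodType) (P : G -> Prop) (u : G) : Prop :=
  forall x : G, exists n : nat, ple P (- (u *+ n)) x /\ ple P x (u *+ n).

Definition simple_poag (G : zmodType) (P : G -> Prop) : Prop :=
  (exists x : G, x <> 0) /\ (forall u, P u -> u <> 0 -> order_unit P u).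

Definition riesz (G : zmodType) (P : G -> Prop) : Prop :=
  forall x y1 y2 : G, P x -> P y1 -> P y2 -> ple P x (y1 + y2) ->
    exists x1 x2 : G, [/\ P x1, P x2, x = x1 + x2, ple P x1 y1 & ple P x2 y2].

Definition additive_hom (G H : zmodType) (f : G -> H) : Prop :=
  forall x y, f (x + y) = f x + f y.

Definition rank_one (G : zmodType) : Prop :=
  (exists x : G, x <> 0) /\
  exists f : G -> rat, additive_hom f /\ injective f.

Definition iso_to_Q (G : zmodType) : Prop :=
  exists f : G -> rat, additive_hom f /\ bijective f.

Definition order_embedding (G H : zmodType) (P : G -> Prop) (Q : H -> Prop)
  (f : G -> H) : Prop :=
  [/\ additive_hom f, injective f &
      forall y : H, (exists x, P x /\ f x = y) <-> ((exists x, f x = y) /\ Q y)].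

(* Main.v *)
(* Idea.  G embeds in the rationals with positive cone Q of nonnegative numbers;
   if G is not isomorphic to the rationals, then G = Q - Q differs from pG for
   some prime p.  Given x <= y1 + y2 in Q, take r = s / p^M with s in G, s not in
   pG and max (0, x - y2) < r < min (x, y1), and add r, x - r, y1 - r, y2 - x + r
   to Q.  For M large no new positive element appears in G, and G + Zr still
   differs from p(G + Zr), so every instance of the Riesz property can be solved
   in turn; the union of the resulting chain of cones is the required Riesz cone.
   Conversely a copy of the rationals has no proper extension of rank one, so an
   order-embedding into a Riesz group would be an isomorphism. *)
From HB Require Import structures.
Require Import Defs.
From mathcomp Require Import all_boot all_order all_algebra.
From mathcomp Require Import boolp.
From mathcomp Require Import zify ring lra.
Set Implicit Arguments. Unset Strict Implicit. Unset Printing Implicit Defensive.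
Import Order.TTheory GRing.Theory Num.Theory.
Local Open Scope ring_scope.

(** * Cones of nonnegative rationals and their groups of differences *)

Definition rat_cone (Q : rat -> Prop) : Prop :=
  [/\ Q 0, forall x y, Q x -> Q y -> Q (x + y) & forall x, Q x -> 0 <= x].

Definition diff (Q : rat -> Prop) (x : rat) : Prop :=
  exists a b, [/\ Q a, Q b & x = a - b].

Lemma cone_muln (Q : rat -> Prop) x n : rat_cone Q -> Q x -> Q (x *+ n).
Proof.
move=> [Q0 QD _] Qx; elim: n => [|n IHn]; first by rewrite mulr0n.
by rewrite mulrS; apply: QD.
Qed.

Lemma cone_diff (Q : rat -> Prop) x : rat_cone Q -> Q x -> diff Q x.
Proof. by move=> [Q0 _ _] Qx; exists x, 0; rewrite subr0. Qed.

Lemma diffB (Q : rat -> Prop) x y :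
  rat_cone Q -> diff Q x -> diff Q y -> diff Q (x - y).
Proof.
move=> [_ QD _] [a [b [Qa Qb ->]]] [a' [b' [Qa' Qb' ->]]].
by exists (a + b'), (b + a'); split; [exact: QD|exact: QD|ring].
Qed.

Lemma diffN (Q : rat -> Prop) x : diff Q x -> diff Q (- x).
Proof. by move=> [a [b [Qa Qb ->]]]; exists b, a; rewrite opprB. Qed.

Lemma diffD (Q : rat -> Prop) x y :
  rat_cone Q -> diff Q x -> diff Q y -> diff Q (x + y).
Proof. by move=> cQ Qx Qy; rewrite -[y]opprK; apply/diffB/diffN. Qed.

Lemma diffMz (Q : rat -> Prop) x (i : int) :
  rat_cone Q -> diff Q x -> diff Q (x *~ i).
Proof.
move=> cQ; have dMn n : diff Q x -> diff Q (x *+ n).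
  move=> [a [b [Qa Qb ->]]].
  by exists (a *+ n), (b *+ n); split; rewrite ?mulrnBl //; exact: cone_muln.
by case: i => n Qx; [apply: dMn | apply/diffN/dMn].
Qed.

(** * Common units for finitely many cone elements *)

Lemma rat_commensurable (x y : rat) : 0 < x -> 0 <= y ->
  exists m n : nat, (0 < m)%N /\ y *+ m = x *+ n.
Proof.
move=> x0 y0; have := divq_num_den (y / x).
have : 0 <= numq (y / x) by rewrite numq_ge0 divr_ge0 // ltW.
have : 0 < denq (y / x) by exact: denq_gt0.
case: (denq _) => // m; case: (numq _) => // n m0 _ /eqP.
have m0' : (m%:R : rat) != 0 by rewrite pnatr_eq0 -lt0n.
rewrite eqr_div ?(gt_eqF x0) // => /eqP e.
by exists m, n; split => //; rewrite -[_ *+ m]mulr_natr -[_ *+ n]mulr_natl.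
Qed.

(** Weaker than [Q c]: two positive elements of a cone may have no common divisor in it, but they
    have one whose large multiples all lie in it. *)
Definition eventually_in (Q : rat -> Prop) (c : rat) : Prop :=
  0 < c /\ exists N : nat, forall n, (N <= n)%N -> Q (c *+ n).

(* For n >= b^2, dividing gives n = q b + t = (q - t) b + t (b + 1) with t < b <= q. *)
Lemma eventually_in_consecutive (Q : rat -> Prop) c (b : nat) : rat_cone Q -> 0 < c ->
  Q (c *+ b) -> Q (c *+ b.+1) -> eventually_in Q c.
Proof.
move=> cQ c0 Qb Qb1; split=> //; exists (b * b)%N => n bn.
have [_ QD _] := cQ.
case: b Qb Qb1 bn => [_ Qb1 _|b Qb Qb1 bn].
  by apply: cone_muln => //; rewrite -[c]mulr1n.
set q := (n %/ b.+1)%N; set t := (n %% b.+1)%N.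
have tb : (t < b.+1)%N by rewrite ltn_mod.
have bq : (b.+1 <= q)%N by rewrite leq_divRL.
have -> : n = (b.+1 * (q - t) + b.+2 * t)%N.
  by rewrite [LHS](divn_eq n b.+1) -/q -/t; nia.
by rewrite mulrnDr !mulrnA; apply: QD; apply: cone_muln.
Qed.

Lemma cone_eventually_in (Q : rat -> Prop) x :
  rat_cone Q -> Q x -> 0 < x -> eventually_in Q x.
Proof. by move=> cQ Qx x0; split=> //; exists 0%N => n _; apply: cone_muln. Qed.

Lemma eventually_in_common (Q : rat -> Prop) c1 c2 : rat_cone Q ->
  eventually_in Q c1 -> eventually_in Q c2 ->
  exists c (m n : nat), [/\ eventually_in Q c, c1 = c *+ m & c2 = c *+ n].
Proof.
move=> cQ [c10 [N1 Q1]] [c20 [N2 Q2]].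
have [m [n [m0 e]]] := rat_commensurable c10 (ltW c20).
have n0 : (0 < n)%N.
  rewrite lt0n; apply/eqP => n0; move: e; rewrite n0 mulr0n => /eqP.
  by rewrite mulrn_eq0 (gt_eqF c20) orbF; case: m m0.
have [u v uv _] := egcdnP n m0.
set g := gcdn m n in uv.
have g0 : (0 < g)%N by rewrite gcdn_gt0 m0.
have /dvdnP[m' em] := dvdn_gcdl m n; have /dvdnP[n' en] := dvdn_gcdr m n.
rewrite -/g in em en.
have m'0 : (0 < m')%N by move: m0; rewrite em muln_gt0 => /andP[].
have n'0 : (0 < n')%N by move: n0; rewrite en muln_gt0 => /andP[].
have m'R : (m'%:R : rat) != 0 by rewrite pnatr_eq0 -lt0n.
have gR : (g%:R : rat) != 0 by rewrite pnatr_eq0 -lt0n.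
(* [c] generates the group spanned by [c1] and [c2]. *)
pose c := c1 / m'%:R.
have ec1 : c1 = c *+ m' by rewrite -mulr_natr divfK.
have ec2 : c2 = c *+ n'.
  apply: (mulIf (x := g%:R)) => //; apply: (mulIf (x := m'%:R)) => //.
  have: c2 * (m' * g)%:R = c1 * (n' * g)%:R by rewrite !mulr_natr -em -en.
  rewrite !natrM => h; rewrite -[c *+ n']mulr_natr -!mulrA [g%:R * _]mulrC h /c.
  by field.
exists c, m', n'; split => //.
(* Adding [K m' n'] to both sides of the Bezout relation [u m' = v n' + 1] keeps the two multiples
   of [c] consecutive and makes the coefficients of [c1] and [c2] exceed the thresholds [N1] and
   [N2]. *)
pose K := (N1 + N2)%N.
have um : (u * m' = v * n' + 1)%N.
  by apply/eqP; rewrite -(eqn_pmul2r g0) mulnDl mul1n -!mulnA -em -en; apply/eqP; lia.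
apply: (@eventually_in_consecutive _ _ (n' * (v + K * m'))%N) => //.
- by rewrite divr_gt0 // ltr0n.
- by rewrite mulrnA -ec2; apply: Q2; nia.
- have -> : (n' * (v + K * m')).+1 = (m' * (u + K * n'))%N by nia.
  by rewrite mulrnA -ec1; apply: Q1; nia.
Qed.

(** * Divisibility by a prime and the adjunction of an interpolant *)

Lemma diff_divX_dvd (Q : rat -> Prop) (p : nat) c M (i : int) :
  prime p -> rat_cone Q -> diff Q c -> ~ diff Q (c / p%:R) ->
  diff Q (c *~ i / p%:R ^+ M) -> (p%:Z ^+ M %| i)%Z.
Proof.
move=> pr cQ Qc nQc; elim: M i => [|M IH] i; first by rewrite expr0 dvd1z.
have pR : (p%:R : rat) != 0 by rewrite pnatr_eq0 -lt0n prime_gt0.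
move=> Qi.
have: (p%:Z ^+ M %| i)%Z.
  apply: IH; have := diffMz p%:Z cQ Qi.
  congr (diff Q _); rewrite -pmulrn -[_ *+ p]mulr_natr exprS; field.
  by rewrite pR expf_neq0.
move=> /dvdzP[k ek]; rewrite ek exprS dvdz_mul //.
have Qk : diff Q (c *~ k / p%:R).
  move: Qi; congr (diff Q _); rewrite ek exprS mulrzA -[_ *~ (_ ^+ _)]mulrzr.
  rewrite rmorphXn /=; field; by rewrite pR expf_neq0.
(* If [p] did not divide [k], a Bezout relation [u k + v p = 1] would express [c / p] through
   [c k / p] and [c]. *)
apply: contrapT => /negP npk; apply: nQc.
have: coprimez k p.
  rewrite coprimez_sym /coprimez /gcdz.
  have := npk; rewrite dvdzE /= => h.
  by rewrite eqz_nat -/(coprime _ _) prime_coprime.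
move=> /coprimezP[[u v] /= uv].
have uvR : u%:~R * k%:~R + v%:~R * p%:R = 1 :> rat.
  by move: (congr1 (fun z : int => z%:~R : rat) uv); rewrite rmorphD !rmorphM.
have -> : c / p%:R = (c *~ k / p%:R) *~ u + c *~ v.
  rewrite -[(_ / _) *~ u]mulrzr -[c *~ k]mulrzr -[c *~ v]mulrzr.
  transitivity (c * (u%:~R * k%:~R + v%:~R * p%:R) / p%:R).
    by rewrite uvR mulr1.
  by field.
by apply: diffD => //; apply: diffMz.
Qed.

(** The four generators are the elements that must be positive for [x = r + (x - r)] to solve the
    Riesz instance [x <= y1 + y2]. *)
Definition comb (x y1 y2 r : rat) (a b c d : nat) : rat :=
  r *+ a + (x - r) *+ b + (y1 - r) *+ c + (y2 - x + r) *+ d.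

Definition adjoin (Q : rat -> Prop) (x y1 y2 r v : rat) : Prop :=
  exists q (a b c d : nat), Q q /\ v = q + comb x y1 y2 r a b c d.

(* Peel off pairs with one term from {r, y2 - x + r} and one from {x - r, y1 - r}:
   they sum to x, y1, y2 or y1 + y2 - x.  The terms left over come from only one
   of the two sets, their number is divisible by N, and blocks of N lie in Q. *)
Lemma comb_in_cone (Q : rat -> Prop) x y1 y2 r (N : nat) (a b c d : nat) :
  rat_cone Q -> Q x -> Q y1 -> Q y2 -> Q (y1 + y2 - x) -> (0 < N)%N ->
  (forall d, (d <= N)%N -> Q (comb x y1 y2 r (N - d) 0 0 d)) ->
  (forall b, (b <= N)%N -> Q (comb x y1 y2 r 0 b (N - b) 0)) ->
  (N%:Z %| (a + d)%:Z - (b + c)%:Z)%Z -> Q (comb x y1 y2 r a b c d).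
Proof.
move=> cQ Qx Qy1 Qy2 Qz N0 Had Hbc; have [Q0 QD _] := cQ.
have [m] := ubnP (a + b + c + d)%N.
elim: m a b c d => // m IH a b c d lem dv.
have step s a' b' c' d' : Q s -> (a' + b' + c' + d' < a + b + c + d)%N ->
    (N%:Z %| (a' + d')%:Z - (b' + c')%:Z)%Z ->
    comb x y1 y2 r a b c d = s + comb x y1 y2 r a' b' c' d' ->
    Q (comb x y1 y2 r a b c d).
  move=> Qs lt' dv' ->; apply: QD => //; apply: IH => //.
  exact: leq_trans lt' _.
have [ad0|ad0] := posnP (a + d)%N; have [bc0|bc0] := posnP (b + c)%N.
- have [-> -> -> ->] : [/\ a = 0, b = 0, c = 0 & d = 0]%N by split; lia.
  by rewrite /comb !mulr0n !addr0.
- have Nbc : (N <= b + c)%N.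
    move: dv; rewrite ad0 sub0r dvdzE abszN => /dvdn_leq; exact.
  have bN : (minn b N <= N)%N by lia.
  apply: (step _ a (b - minn b N)%N (c - (N - minn b N))%N d (Hbc _ bN)).
  + lia.
  + have -> : (a + d)%:Z - (b - minn b N + (c - (N - minn b N)))%N%:Z =
      (a + d)%:Z - (b + c)%:Z + N%:Z by lia.
    by apply: rpredD => //; exact: dvdzz.
  + rewrite /comb -{1}(@subnK (minn b N) b); last lia.
    rewrite -{1}(@subnK (N - minn b N) c); last lia.
    rewrite !mulrnDr !mulr0n; ring.
- have Nad : (N <= a + d)%N.
    move: dv; rewrite bc0 subr0 dvdzE /= => /dvdn_leq; exact.
  have dN : (minn d N <= N)%N by lia.
  apply: (step _ (a - (N - minn d N))%N b c (d - minn d N)%N (Had _ dN)).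
  + lia.
  + have -> : (a - (N - minn d N) + (d - minn d N))%N%:Z - (b + c)%:Z =
      (a + d)%:Z - (b + c)%:Z - N%:Z by lia.
    by apply: rpredB => //; exact: dvdzz.
  + rewrite /comb -{1}(@subnK (minn d N) d); last lia.
    rewrite -{1}(@subnK (N - minn d N) a); last lia.
    rewrite !mulrnDr !mulr0n; ring.
- case: a step ad0 dv {lem} => [|a] step ad0 dv; case: b step bc0 dv => [|b] step bc0 dv.
  + case: d step ad0 dv => [|d] step ad0 dv //; case: c step bc0 dv => [|c] step bc0 dv //.
    apply: (step (y1 + y2 - x) 0%N 0%N c d Qz); first lia.
      by move: dv; congr (_ %| _)%Z; lia.
    by rewrite /comb !mulrS; ring.
  + case: d step ad0 dv => [|d] step ad0 dv //.
    apply: (step y2 0%N b c d Qy2); first lia.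
      by move: dv; congr (_ %| _)%Z; lia.
    by rewrite /comb !mulrS; ring.
  + case: c step bc0 dv => [|c] step bc0 dv //.
    apply: (step y1 a 0%N c d Qy1); first lia.
      by move: dv; congr (_ %| _)%Z; lia.
    by rewrite /comb !mulrS; ring.
  + apply: (step x a b c d Qx); first lia.
      by move: dv; congr (_ %| _)%Z; lia.
    by rewrite /comb !mulrS; ring.
Qed.

(** The invariant of the chain. The witness can be taken in [Q] because [Q] generates [diff Q]. *)
Definition indivisible_cone (p : nat) (Q : rat -> Prop) : Prop :=
  rat_cone Q /\ exists2 h, Q h & ~ diff Q (h / p%:R).

(** The choice [j = lo p^M + p T + 1] is 1 modulo [p], and [j + T = lo p^M + M] stays below [hi p^M]
    because [M < p^M]. *)
Lemma exists_interpolation_index (p lo hi T : nat) : prime p -> (lo < hi)%N ->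
  exists M j : nat, [/\ ~~ (p %| j)%N, (lo * p ^ M + T <= j)%N
    & (j + T <= hi * p ^ M)%N].
Proof.
move=> pr lohi; set M := ((p + 1) * T + 1)%N.
have pM : (M < p ^ M)%N by rewrite ltn_expl // prime_gt1.
have M0 : (0 < M)%N by rewrite /M addn1.
exists M, (lo * p ^ M + p * T + 1)%N; split.
- rewrite dvdn_addr; first by rewrite dvdn1 gtn_eqF // prime_gt1.
  by apply: dvdn_add; [exact/dvdn_mull/dvdn_exp | exact: dvdn_mulr].
- have := prime_gt1 pr; nia.
- have := prime_gt1 pr; nia.
Qed.

Lemma comb_shift x y1 y2 r a b c d :
  comb x y1 y2 r a b c d =
  r *~ ((a + d)%:Z - (b + c)%:Z) + (x *+ b + y1 *+ c + (y2 - x) *+ d).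
Proof. by rewrite /comb; ring. Qed.

(** Modulo [diff Q] the four generators are [r], [-r], [-r] and [r], so only the signed number of
    terms counts. *)
Lemma comb_diff (Q : rat -> Prop) x y1 y2 r a b c d :
  rat_cone Q -> Q x -> Q y1 -> Q y2 ->
  diff Q (comb x y1 y2 r a b c d - r *~ ((a + d)%:Z - (b + c)%:Z)).
Proof.
move=> cQ Qx Qy1 Qy2; have [_ QD _] := cQ.
exists (x *+ b + y1 *+ c + y2 *+ d), (x *+ d).
split; last by rewrite comb_shift; ring.
  by apply: (QD); [apply: QD|]; apply: cone_muln.
exact: cone_muln.
Qed.

Lemma rat_cone_adjoin (Q : rat -> Prop) x y1 y2 r : rat_cone Q ->
  0 <= r -> r <= x -> r <= y1 -> x <= y2 + r ->
  rat_cone (adjoin Q x y1 y2 r).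
Proof.
move=> [Q0 QD Qge] r0 rx ry1 xy; split.
- by exists 0, 0%N, 0%N, 0%N, 0%N; split; rewrite // /comb !mulr0n !addr0.
- move=> _ _ [q [a [b [c [d [Qq ->]]]]]] [q' [a' [b' [c' [d' [Qq' ->]]]]]].
  exists (q + q'), (a + a')%N, (b + b')%N, (c + c')%N, (d + d')%N.
  by split; [exact: QD|rewrite /comb; ring].
- move=> _ [q [a [b [c [d [/Qge Qq ->]]]]]].
  by rewrite /comb !addr_ge0 // mulrn_wge0 //; lra.
Qed.

Lemma sub_adjoin (Q : rat -> Prop) x y1 y2 r v : Q v -> adjoin Q x y1 y2 r v.
Proof.
move=> Qv; exists v, 0%N, 0%N, 0%N, 0%N.
by split; rewrite // /comb !mulr0n !addr0.
Qed.

(* With r = j c / p^M and p not dividing j, a multiple of r lies in Q - Q only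
   when p^M divides the multiplier; this is what keeps the extension
   conservative.  The margin T in the choice of j places the sums of N terms
   needed by comb_in_cone among the multiples n c with n >= T, which lie in Q. *)
Lemma interpolation_step p (Q : rat -> Prop) x y1 y2 :
  prime p -> indivisible_cone p Q -> 0 < x -> 0 < y1 -> 0 < y2 ->
  0 < y1 + y2 - x -> Q x -> Q y1 -> Q y2 -> Q (y1 + y2 - x) ->
  exists Q' : rat -> Prop, [/\ indivisible_cone p Q',
    forall v, Q v -> Q' v,
    forall v, Q' v -> diff Q v -> Q v &
    exists r, [/\ Q' r, Q' (x - r), Q' (y1 - r) & Q' (y2 - (x - r))]].
Proof.
move=> pr [cQ [h Qh nQh]] x0 y10 y20 z0 Qx Qy1 Qy2 Qz.
have [_ _ Qge] := cQ.
have h0 : 0 < h.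
  rewrite lt_neqAle Qge // andbT eq_sym; apply/eqP => h0; apply: nQh.
  by rewrite h0 mul0r; apply: cone_diff => //; case: cQ.
have ev := cone_eventually_in cQ.
(* One unit [c] measures [x], [y1], [y2] and also [h]; the last keeps [c / p] out of [diff Q]. *)
have [c1 [X1 [Y1 [ec1 ex ey1]]]] := eventually_in_common cQ (ev _ Qx x0) (ev _ Qy1 y10).
have [c2 [A2 [Y2 [ec2 e21 ey2]]]] := eventually_in_common cQ ec1 (ev _ Qy2 y20).
have [c [A3 [H [[c0 [T QT]] e3 eh]]]] := eventually_in_common cQ ec2 (ev _ Qh h0).
subst c2 c1.
move: ex ey1 ey2; rewrite -!mulrnA.
set X := (A3 * _)%N; set Y := (A3 * _)%N; set Z := (A3 * _)%N => ex ey1 ey2.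
have Qc : diff Q c.
  by exists (c *+ T.+1), (c *+ T); split; [exact: QT|exact: QT|rewrite mulrS addrK].
have nQc : ~ diff Q (c / p%:R).
  move=> Qcp; apply: nQh; rewrite eh.
  have := diffMz H%:Z cQ Qcp; congr (diff Q _).
  by rewrite -pmulrn -[LHS]mulr_natr -[c *+ H]mulr_natr mulrAC.
have nge n : (0 < c *+ n) = (0 < n)%N.
  by case: n => [|n]; rewrite ?mulr0n ?ltxx // mulrn_wgt0.
have X0 : (0 < X)%N by rewrite -nge -ex.
have Y0 : (0 < Y)%N by rewrite -nge -ey1.
have Z0 : (0 < Z)%N by rewrite -nge -ey2.
have XYZ : (X < Y + Z)%N.
  by rewrite -(ltr_pMn2l c0) mulrnDr -ex -ey1 -ey2; lra.
(* Truncated subtraction makes [X - Z] the bound max (0, x - y2) in units of [c]. *)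
have lohi : (X - Z < minn X Y)%N by lia.
have [M [j [npj jlo jhi]]] := exists_interpolation_index T pr lohi.
set N := (p ^ M)%N in jlo jhi.
have N0 : (0 < N)%N by rewrite expn_gt0 prime_gt0.
have jX : (j + T <= X * N)%N by rewrite (leq_trans jhi) // leq_mul2r geq_minl orbT.
have jY : (j + T <= Y * N)%N by rewrite (leq_trans jhi) // leq_mul2r geq_minr orbT.
(* Since [N r = j c], blocks of [N] generators of one sign are multiples of [c]: [(j + Z k - X k) c]
   for [r] and [y2 - x + r], and [(X k + Y (N - k) - j) c] for [x - r] and [y1 - r]. Both
   multipliers are at least [T]. *)
have jXZ k : (k <= N)%N -> (T + X * k <= j + Z * k)%N.
  move=> kN; have lek : ((X - Z) * k <= (X - Z) * N)%N by rewrite leq_mul2l kN orbT.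
  have : (X * k <= (X - Z) * k + Z * k)%N.
    by rewrite -mulnDl leq_mul2r; apply/orP; right; clear; lia.
  by move: lek jlo; clear; lia.
have jXY k : (k <= N)%N -> (T + j <= X * k + Y * (N - k))%N.
  move=> kN; rewrite addnC (leq_trans jhi) // -{1}(subnKC kN) mulnDr.
  by rewrite leq_add // leq_mul2r ?geq_minl ?geq_minr orbT.
have NR : (N%:R : rat) != 0 by rewrite pnatr_eq0 -lt0n.
have pR : (p%:R : rat) != 0 by rewrite pnatr_eq0 -lt0n prime_gt0.
pose r := c *+ j / N%:R.
have rN : r *+ N = c *+ j by rewrite -mulr_natr divfK.
have N0R : (0 : rat) < N%:R by rewrite ltr0n.
have r0 : 0 <= r by rewrite divr_ge0 ?ler0n // mulrn_wge0 // ltW.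
have rx : r <= x.
  by rewrite ler_pdivrMr // ex mulr_natr -mulrnA ler_pMn2l // (leq_trans (leq_addr T j)).
have ry : r <= y1.
  by rewrite ler_pdivrMr // ey1 mulr_natr -mulrnA ler_pMn2l // (leq_trans (leq_addr T j)).
have xr : x <= y2 + r.
  rewrite -lerBlDl ler_pdivlMr // ex ey2 mulr_natr mulrnBl -!mulrnA.
  rewrite lerBlDl -mulrnDr ler_pMn2l // [leqRHS]addnC.
  exact: leq_trans (leq_addl T _) (jXZ N (leqnn N)).
(* The exponent [k = 0] serves conservativity, and [k = 1] shows that [r / p] is not a difference in
   the new cone. *)
have divr (i : int) k : diff Q (r *~ i / p%:R ^+ k) -> (p%:Z ^+ (M + k) %| i)%Z.
  move=> Qr; have := @diff_divX_dvd Q p c (M + k) (j%:Z * i) pr cQ Qc nQc.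
  rewrite Gauss_dvdzr; last first.
    rewrite coprimezXl // coprimezE /= prime_coprime //.
  apply; move: Qr; congr (diff Q _).
  rewrite /r /N natrX exprD mulrzA -pmulrn.
  rewrite -[_ *~ i]mulrzr -[(c *+ j) *~ i]mulrzr; field.
  by rewrite !expf_neq0.
have cons v : adjoin Q x y1 y2 r v -> diff Q v -> Q v.
  move=> [q [a [b [e [d [Qq ->]]]]]] Qv; have [_ QD _] := cQ.
  apply: QD => //; apply: (comb_in_cone cQ Qx Qy1 Qy2 Qz N0).
  - move=> k kN; have [l [Tl el]] : exists l, (T <= l)%N /\ (l + X * k = j + Z * k)%N.
      by exists (j + Z * k - X * k)%N; have := jXZ k kN; clear; lia.
    have := QT _ Tl; congr Q.
    rewrite comb_shift subnK // addn0 !mulr0n addr0 !add0r -pmulrn rN.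
    apply: (addIr (x *+ k)); rewrite {1}ex -mulrnA -mulrnDr el mulrnDr mulrnA -ey2.
    ring.
  - move=> k kN; have [l [Tl el]] : exists l, (T <= l)%N /\ (l + j = X * k + Y * (N - k))%N.
      by exists (X * k + Y * (N - k) - j)%N; have := jXY k kN; clear; lia.
    have := QT _ Tl; congr Q.
    rewrite comb_shift subnKC // addn0 !mulr0n addr0 sub0r mulrNz -pmulrn rN.
    apply: (addIr (c *+ j)); rewrite -mulrnDr el mulrnDr.
    rewrite [c *+ (X * k)]mulrnA [c *+ (Y * _)]mulrnA -ex -ey1.
    ring.
  - have : diff Q (r *~ ((a + d)%:Z - (b + e)%:Z) / p%:R ^+ 0).
      rewrite expr0 divr1.
      have := diffB cQ (diffB cQ Qv (cone_diff cQ Qq)) (comb_diff r a b e d cQ Qx Qy1 Qy2).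
      by congr (diff Q _); ring.
    by move/divr; rewrite addn0 !dvdzE abszX.
have adj a b e d : adjoin Q x y1 y2 r (comb x y1 y2 r a b e d).
  by exists 0, a, b, e, d; rewrite add0r; case: cQ.
exists (adjoin Q x y1 y2 r); split => //.
- split; first exact: rat_cone_adjoin.
  exists r; first by have := adj 1%N 0%N 0%N 0%N; congr adjoin; rewrite /comb; ring.
  move=> [_ [_ [[q [a [b [e [d [Qq ->]]]]]] [q' [a' [b' [e' [d' [Qq' ->]]]]]] er]]].
  (* If [r / p] were a difference in the new cone, it would equal [k r] modulo [diff Q], and [p]
     would divide [1 - p k]. *)
  set k := ((a + d)%:Z - (b + e)%:Z) - ((a' + d')%:Z - (b' + e')%:Z).
  have : diff Q (r *~ (1 - p%:Z * k) / p%:R ^+ 1).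
    have D1 := diffB cQ (cone_diff cQ Qq) (cone_diff cQ Qq').
    have D2 := diffB cQ (comb_diff r a b e d cQ Qx Qy1 Qy2)
                 (comb_diff r a' b' e' d' cQ Qx Qy1 Qy2).
    have := diffD cQ D1 D2; congr (diff Q _).
    have -> : r *~ (1 - p%:Z * k) / p%:R ^+ 1 = r / p%:R - r *~ k.
      rewrite expr1 -[r *~ (1 - _)]mulrzr -[r *~ k]mulrzr rmorphB rmorphM /=.
      by field.
    by rewrite er /k; ring.
  move/divr; rewrite addn1 => dvp1.
  have dvp : (p%:Z %| 1 - p%:Z * k)%Z.
    by apply: dvdz_trans dvp1; apply: dvdz_exp => //; exact: dvdzz.
  have := rpredD dvp (dvdz_mulr k (dvdzz p%:Z)).
  by rewrite subrK dvdz1 /= => /eqP p1; move: pr; rewrite p1.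
- by move=> v; apply: sub_adjoin.
- exists r; split.
  + by have := adj 1%N 0%N 0%N 0%N; congr adjoin; rewrite /comb; ring.
  + by have := adj 0%N 1%N 0%N 0%N; congr adjoin; rewrite /comb; ring.
  + by have := adj 0%N 0%N 1%N 0%N; congr adjoin; rewrite /comb; ring.
  + by have := adj 0%N 0%N 0%N 1%N; congr adjoin; rewrite /comb; ring.
Qed.

(** * Solving all Riesz instances along a chain of cones *)

Definition interpolates (Q Q' : rat -> Prop) (x y1 y2 : rat) : Prop :=
  Q x -> Q y1 -> Q y2 -> Q (y1 + y2 - x) ->
  exists r, [/\ Q' r, Q' (x - r), Q' (y1 - r) & Q' (y2 - (x - r))].

(** When one of the four positive elements vanishes, [0], [x] or [y1] already interpolates inside
    [Q]; only the strict case needs an extension. *)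
Lemma interpolation_extension p (Q : rat -> Prop) x y1 y2 :
  prime p -> indivisible_cone p Q ->
  exists Q' : rat -> Prop, [/\ indivisible_cone p Q',
    forall v, Q v -> Q' v,
    forall v, Q' v -> diff Q v -> Q v & interpolates Q Q' x y1 y2].
Proof.
move=> pr iQ; have [[Q0 QD Qge] _] := iQ.
have triv : interpolates Q Q x y1 y2 -> exists Q' : rat -> Prop,
    [/\ indivisible_cone p Q', forall v, Q v -> Q' v,
        forall v, Q' v -> diff Q v -> Q v & interpolates Q Q' x y1 y2].
  by move=> iQQ; exists Q.
have pos v : Q v -> v != 0 -> 0 < v by move=> /Qge v0 vn0; rewrite lt_def vn0.
have [x0|x0] := eqVneq x 0.
  by apply: triv => Qx Qy1 Qy2 _; exists 0; rewrite x0 !subr0.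
have [y10|y10] := eqVneq y1 0.
  by apply: triv => Qx _ Qy2; rewrite y10 add0r => Qz; exists 0; rewrite !subr0.
have [y20|y20] := eqVneq y2 0.
  apply: triv => Qx Qy1 _; rewrite y20 addr0 => Qz; exists x.
  by rewrite subrr subr0.
have [z0|z0] := eqVneq (y1 + y2 - x) 0.
  apply: triv => Qx Qy1 Qy2 _; exists y1.
  have -> : x - y1 = y2 by lra.
  by rewrite !subrr.
have [[Qx Qy1 Qy2 Qz]|n] := EM [/\ Q x, Q y1, Q y2 & Q (y1 + y2 - x)].
  have [Q' [? ? ? ?]] := interpolation_step pr iQ (pos _ Qx x0) (pos _ Qy1 y10)
    (pos _ Qy2 y20) (pos _ Qz z0) Qx Qy1 Qy2 Qz.
  by exists Q'; split.
by apply: triv => Qx Qy1 Qy2 Qz; case: n.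
Qed.

Lemma interpolation_envelope p (Q : rat -> Prop) :
  prime p -> indivisible_cone p Q ->
  exists Q' : rat -> Prop, [/\ rat_cone Q', forall v, Q v -> Q' v,
    forall v, Q' v -> diff Q v -> Q v &
    forall x y1 y2, interpolates Q' Q' x y1 y2].
Proof.
move=> pr iQ.
(* For a total choice function, indivisibility is moved into the property; other predicates are
   returned unchanged. *)
have /choice[ext extP] (tQ : (rat * rat * rat) * (rat -> Prop)) :
    exists Q' : rat -> Prop, indivisible_cone p tQ.2 ->
    [/\ indivisible_cone p Q', forall v, tQ.2 v -> Q' v,
    forall v, Q' v -> diff tQ.2 v -> tQ.2 v &
    interpolates tQ.2 Q' tQ.1.1.1 tQ.1.1.2 tQ.1.2].
  case: tQ => [[[x y1] y2] Q1] /=.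
  have [iQ1|niQ1] := EM (indivisible_cone p Q1); last by exists Q1 => /niQ1.
  by have [Q' ?] := interpolation_extension x y1 y2 pr iQ1; exists Q'.
(* logn 2 n takes every value infinitely often, so each triple recurs after the
   stage at which its entries enter the cone. *)
pose task n : rat * rat * rat := odflt (0, 0, 0) (unpickle (logn 2 n)).
pose F := fix F n := if n is n'.+1 then ext (task n', F n') else Q.
have iF n : indivisible_cone p (F n).
  by elim: n => //= n IH; have [] := extP (task n, F n) IH.
have Fle m n v : (m <= n)%N -> F m v -> F n v.
  move=> /subnK <-; elim: (n - m)%N => //= k IH Fv.
  by have [_ + _ _] := extP (task (k + m)%N, F (k + m)%N) (iF _); apply; exact: IH.
(* An element of [diff Q] lies in [diff (F n)] for every [n], so it descends through the chain one
   stage at a time. *)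
have Fcons n v : F n v -> diff Q v -> Q v.
  elim: n => //= n IH Fv Qv; apply: IH => //.
  have [_ _ + _] := extP (task n, F n) (iF n); apply => //.
  by case: Qv => a [b [Qa Qb ->]]; exists a, b; split => //; apply: (@Fle 0%N).
have Fint n : interpolates (F n) (F n.+1) (task n).1.1 (task n).1.2 (task n).2.
  by have [] := extP (task n, F n) (iF n).
exists (fun v => exists n, F n v); split.
- split.
  + by exists 0%N; have [[]] := iQ.
  + move=> x y [m Fx] [n Fy]; exists (maxn m n).
    have [[_ FD _] _] := iF (maxn m n).
    by apply: FD; [apply: Fle Fx; exact: leq_maxl | apply: Fle Fy; exact: leq_maxr].
  + by move=> x [n]; have [[_ _ +] _] := iF n; apply.
- by move=> v Qv; exists 0%N.
- by move=> v [n]; apply: Fcons.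
- move=> x y1 y2 [n1 F1] [n2 F2] [n3 F3] [n4 F4].
  pose m := (n1 + n2 + n3 + n4)%N; pose i := pickle (x, y1, y2).
  pose n := (2 ^ i * m.*2.+1)%N.
  have mn : (m <= n)%N.
    have : (0 < 2 ^ i)%N by rewrite expn_gt0.
    by rewrite /n -muln2; nia.
  have tn : task n = (x, y1, y2).
    rewrite /task /n lognM ?expn_gt0 // pfactorK // logn_coprime; last first.
      by rewrite coprime2n /= odd_double.
    by rewrite addn0 pickleK.
  have n1n : (n1 <= n)%N by apply: leq_trans mn; rewrite /m; lia.
  have n2n : (n2 <= n)%N by apply: leq_trans mn; rewrite /m; lia.
  have n3n : (n3 <= n)%N by apply: leq_trans mn; rewrite /m; lia.
  have n4n : (n4 <= n)%N by apply: leq_trans mn; rewrite /m; lia.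
  have := Fint n; rewrite tn.
  move=> /(_ (Fle _ _ _ n1n F1) (Fle _ _ _ n2n F2) (Fle _ _ _ n3n F3)).
  move=> /(_ (Fle _ _ _ n4n F4)) [r [? ? ? ?]].
  by exists r; split; exists n.+1.
Qed.

(** * The group of differences as a simple Riesz group of rank one *)

Record cone := Cone { cone_pred :> rat -> Prop; coneP : rat_cone cone_pred }.

Definition diffb (Q : cone) : pred rat := fun x => `[< diff Q x >].

Fact diffb_zmod_closed (Q : cone) : zmod_closed (diffb Q).
Proof.
split; first by apply/asboolP/cone_diff; [exact: coneP|case: (coneP Q)].
by move=> x y /asboolP Qx /asboolP Qy; apply/asboolP/diffB => //; exact: coneP.
Qed.

HB.instance Definition _ (Q : cone) :=
  GRing.isZmodClosed.Build rat (diffb Q) (diffb_zmod_closed Q).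

(** The carrier is [diff Q] rather than all of [rat]: a rational outside it lies below no element of
    [Q], which would contradict simplicity. *)
Record diff_group (Q : cone) :=
  DiffGroup { diff_val :> rat; _ : diff_val \in diffb Q }.

HB.instance Definition _ (Q : cone) := [isSub for @diff_val Q].
HB.instance Definition _ (Q : cone) := [Choice of diff_group Q by <:].
HB.instance Definition _ (Q : cone) :=
  [SubChoice_isSubZmodule of diff_group Q by <:].

Definition diff_cone (Q : cone) (x : diff_group Q) : Prop := Q (val x).

Lemma diff_cone_poag (Q : cone) : is_poag (@diff_cone Q).
Proof.
have [Q0 QD Qge] := coneP Q; split; rewrite /diff_cone.
- by rewrite raddf0.
- by move=> x y Qx Qy; rewrite raddfD; apply: QD.
- move=> x /Qge x0 /Qge; rewrite raddfN oppr_ge0 => x0'.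
  by apply/val_inj; rewrite raddf0; apply/le_anti; rewrite x0 x0'.
Qed.

(** Some [(m + 1) b] equals [n u]; adding it turns [a - b] into [a + m b]. *)
Lemma diff_add_unit (Q : rat -> Prop) u x : rat_cone Q -> Q u -> u != 0 ->
  diff Q x -> exists n, Q (x + u *+ n).
Proof.
move=> cQ Qu u0 [a [b [Qa Qb ->]]]; have [_ QD Qge] := cQ.
have up : 0 < u by rewrite lt_def u0 Qge.
have [[|m] [n [// _ e]]] := rat_commensurable up (Qge _ Qb).
exists n; rewrite -e; have -> : a - b + b *+ m.+1 = a + b *+ m by rewrite mulrS; ring.
by apply: QD => //; apply: cone_muln.
Qed.

Lemma diff_cone_simple (Q : cone) u : Q u -> u != 0 -> simple_poag (@diff_cone Q).
Proof.
move=> Qu u0; have cQ := coneP Q; have [_ QD _] := cQ; split.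
  have Du : u \in diffb Q by apply/asboolP/cone_diff.
  exists (DiffGroup Du) => /(congr1 val); rewrite raddf0 => /eqP.
  by apply/negP.
move=> w Qw w0 x.
have wn0 : val w != 0 by apply/eqP => h; apply: w0; apply/val_inj; rewrite raddf0.
have Dx : diff Q (val x) by apply/asboolP/(valP x).
have [n Qn] := diff_add_unit cQ Qw wn0 Dx.
have [n' Qn'] := diff_add_unit cQ Qw wn0 (diffN Dx).
exists (n + n')%N; rewrite /ple /diff_cone !raddfB raddfN raddfMn mulrnDr; split.
  by rewrite opprK addrA; apply: QD => //; exact: cone_muln.
rewrite [X in Q X](_ : _ = - val x + val w *+ n' + val w *+ n); last by ring.
by apply: QD => //; exact: cone_muln.
Qed.

Lemma diff_cone_riesz (Q : cone) :
  (forall x y1 y2, interpolates Q Q x y1 y2) -> riesz (@diff_cone Q).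
Proof.
move=> iQ x y1 y2 Qx Qy1 Qy2; rewrite /ple /diff_cone raddfB raddfD => Qz.
have [r [Qr Qxr Qy1r Qy2r]] := iQ _ _ _ Qx Qy1 Qy2 Qz.
have Dr : r \in diffb Q by apply/asboolP/cone_diff => //; exact: coneP.
have valB (a b : diff_group Q) : val (a - b) = val a - val b by rewrite raddfB.
exists (DiffGroup Dr), (x - DiffGroup Dr).
split; [exact: Qr | | by rewrite [RHS]addrC subrK | |].
- by rewrite valB; exact: Qxr.
- by rewrite valB; exact: Qy1r.
- by rewrite !valB; exact: Qy2r.
Qed.

Lemma diff_group_rank_one (Q : cone) u : Q u -> u != 0 -> rank_one (diff_group Q).
Proof.
move=> Qu u0; split; first by have [] := diff_cone_simple Qu u0.
exists val; split; last exact: val_inj.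
by move=> x y; rewrite raddfD.
Qed.

(** * Additive maps and embeddings of copies of the rationals *)

Lemma additive_hom0 (G H : zmodType) (f : G -> H) : additive_hom f -> f 0 = 0.
Proof. by move=> fD; apply: (addIr (f 0)); rewrite -fD !add0r. Qed.

Lemma additive_homMz (G H : zmodType) (f : G -> H) x (i : int) :
  additive_hom f -> f (x *~ i) = f x *~ i.
Proof.
move=> fD; have f0 := additive_hom0 fD.
have fMn n : f (x *+ n) = f x *+ n.
  by elim: n => [|n IH]; rewrite ?mulr0n // !mulrS fD IH.
case: i => n; first exact: fMn.
by apply: (addIr (f (x *+ n.+1))); rewrite -fD [RHS]addrC fMn !addNr ?subrr.
Qed.

Lemma additive_hom_rat (k : rat -> rat) q : additive_hom k -> k q = q * k 1.
Proof.
move=> kD; have d0 : ((denq q)%:~R : rat) != 0 by rewrite intr_eq0 denq_neq0.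
apply: (mulIf d0); rewrite mulrzr -(additive_homMz _ _ kD) -mulrzr.
have <- : (numq q)%:~R = q * (denq q)%:~R by rewrite -{2}(divq_num_den q) divfK.
rewrite (additive_homMz _ _ kD) -mulrzr -{2}(divq_num_den q); by field.
Qed.

(** Read through the rationals on both sides, [f] becomes multiplication by the nonzero number
    [k 1], which can be inverted. *)
Lemma iso_to_Q_embedding_surj (G H : zmodType) (f : G -> H) :
  iso_to_Q G -> rank_one H -> additive_hom f -> injective f ->
  forall y, exists x, f x = y.
Proof.
move=> [phi [phiD [psi phiK psiK]]] [_ [g [gD gi]]] fD fi y.
have psiD : additive_hom psi.
  by move=> a b; apply: (can_inj phiK); rewrite phiD !psiK.
pose k := g \o f \o psi.
have kD : additive_hom k by move=> a b; rewrite /k /= psiD fD gD.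
have k1 : k 1 != 0.
  rewrite -(additive_hom0 kD); apply/eqP => /gi/fi/(can_inj psiK) /eqP.
  by rewrite oner_eq0.
exists (psi (g y / k 1)); apply: gi.
by rewrite -[LHS]/(k _) additive_hom_rat // divfK.
Qed.

Lemma riesz_order_iso (G H : zmodType) (P : G -> Prop) (Q : H -> Prop) (f : G -> H) :
  order_embedding P Q f -> (forall y, exists x, f x = y) -> riesz Q -> riesz P.
Proof.
move=> [fD fi PQ] fs rQ.
have PQE x : P x <-> Q (f x).
  split=> [Px|Qx].
    by have [+ _] := PQ (f x) => -[|_]; [exists x|].
  by have [_ [|x' [Px' /fi <-]]] := PQ (f x); first by split=> //; exists x.
have fB x y : f (x - y) = f x - f y.
  by apply: (addIr (f y)); rewrite -fD !subrK.
move=> x y1 y2 /PQE Qx /PQE Qy1 /PQE Qy2 /PQE; rewrite fB fD => Qz.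
have [w1 [w2 [Qw1 Qw2 xw le1 le2]]] := rQ _ _ _ Qx Qy1 Qy2 Qz.
have [[x1 e1] [x2 e2]] := (fs w1, fs w2); subst w1 w2.
by exists x1, x2; split; try (by apply/PQE; rewrite ?fB); apply: fi; rewrite fD.
Qed.

(** * Choice of the prime and of the sign, and assembly *)

Lemma indivisible_prime (Q : rat -> Prop) u t : rat_cone Q -> Q u -> u != 0 ->
  ~ diff Q t -> exists2 p, prime p & indivisible_cone p Q.
Proof.
move=> cQ Qu u0 nQt; apply: contrapT => npQ; apply: nQt.
have dp p x : prime p -> diff Q x -> diff Q (x / p%:R).
  move=> pr; suff dQ y : Q y -> diff Q (y / p%:R).
    by move=> [a [b [/dQ Qa /dQ Qb ->]]]; rewrite mulrBl; apply: diffB.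
  move=> Qy; apply: contrapT => nQy; apply: npQ.
  by exists p => //; split => //; exists y.
(* If no prime is suitable, [diff Q] is divisible and contains every rational multiple of [u], hence
   [t]. *)
have dn n x : (0 < n)%N -> diff Q x -> diff Q (x / n%:R).
  elim/ltn_ind: n x => n IH x n0 Qx.
  have [n1|n1] := leqP n 1.
    by have -> : n = 1%N by [lia]; rewrite divr1.
  have := divnK (pdiv_dvd n); have pr := pdiv_prime n1 => e.
  rewrite -e natrM invfM mulrA; apply: dp => //; apply: IH => //.
    by rewrite ltn_Pdiv // prime_gt1.
  by rewrite divn_gt0 ?pdiv_gt0 // pdiv_leq.
have := divq_num_den (t / u); have := denq_gt0 (t / u).
case: (denq _) => // d d0 e.
rewrite -[t](divfK u0) -e.
have := dn d _ d0 (diffMz (numq (t / u)) cQ (cone_diff cQ Qu)).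
by congr (diff Q _); rewrite -mulrzr -pmulrn; ring.
Qed.

(** If [f x < 0], then [m x + n u = 0] with [m > 0], so [m x] and its opposite are both positive and
    [m x] vanishes. *)
Lemma positive_embedding (G : zmodType) (P : G -> Prop) (f : G -> rat) u :
  is_poag P -> additive_hom f -> injective f -> P u -> 0 < f u ->
  forall x, P x -> 0 <= f x.
Proof.
move=> [P0 PD Panti] fD fi Pu fu x Px; rewrite leNgt; apply/negP => fx.
have PMn n y : P y -> P (y *+ n).
  by move=> Py; elim: n => [|n IH]; rewrite ?mulr0n // mulrS; apply: PD.
have fMn n y : f (y *+ n) = f y *+ n by exact: (additive_homMz y n%:Z fD).
have fNx : 0 <= - f x by rewrite oppr_ge0 ltW.
have [m [n [m0 e]]] := rat_commensurable fu fNx.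
have xu : x *+ m + u *+ n = 0.
  by apply: fi; rewrite fD !fMn -e mulNrn subrr additive_hom0.
have := Panti _ (PMn m _ Px).
have -> : - (x *+ m) = u *+ n by apply/eqP; rewrite eq_sym -addr_eq0 addrC xu.
move=> /(_ (PMn n _ Pu)) /(congr1 f); rewrite fMn additive_hom0 // => /eqP.
by rewrite mulrn_eq0 (lt_eqF fx) orbF; case: m m0 {e xu}.
Qed.

Lemma exists_positive_embedding (G : zmodType) (P : G -> Prop) u :
  is_poag P -> rank_one G -> P u -> u <> 0 ->
  exists f : G -> rat, [/\ additive_hom f, injective f, f u != 0 &
    forall x, P x -> 0 <= f x].
Proof.
move=> oP [_ [f [fD fi]]] Pu u0.
have fu0 : f u != 0 by apply/eqP; rewrite -(additive_hom0 fD) => /fi.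
have [fu|fu] := ltP 0 (f u).
  by exists f; split => //; exact: positive_embedding fu.
have ND : additive_hom (fun x => - f x) by move=> x y; rewrite fD opprD.
have Ni : injective (fun x => - f x) by move=> x y /oppr_inj /fi.
exists (fun x => - f x); split; rewrite ?oppr_eq0 //.
by apply: (positive_embedding oP ND Ni Pu); rewrite oppr_gt0 lt_neqAle fu0.
Qed.

(** The zero cone has the Riesz property. Simplicity alone does not provide a nonzero positive
    element. *)
Lemma not_riesz_neq0 (G : zmodType) (P : G -> Prop) :
  is_poag P -> ~ riesz P -> exists2 u, P u & u <> 0.
Proof.
move=> [P0 _ _] nr; apply: contrapT => nP; apply: nr => x y1 y2 Px Py1 Py2 _.
have P_0 v : P v -> v = 0.
  by move=> Pv; apply: contrapT => v0; apply: nP; exists v.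
rewrite (P_0 x) // (P_0 y1) // (P_0 y2) //; exists 0, 0.
by rewrite /ple subr0 addr0.
Qed.

Lemma riesz_envelope (G : zmodType) (P : G -> Prop) u :
  is_poag P -> simple_poag P -> rank_one G -> P u -> u <> 0 -> ~ iso_to_Q G ->
  exists (H : zmodType) (Q : H -> Prop),
      [/\ is_poag Q, simple_poag Q, riesz Q, rank_one H &
          exists f : G -> H, order_embedding P Q f].
Proof.
move=> oP [_ sP] rG Pu u0 nGQ.
have [f [fD fi fu fge]] := exists_positive_embedding oP rG Pu u0.
have [P0 PD _] := oP.
have fB x y : f (x - y) = f x - f y.
  by apply: (addIr (f y)); rewrite -fD !subrK.
pose Q0 (v : rat) := exists2 x, P x & f x = v.
have Q0f x : P x -> Q0 (f x) by move=> Px; exists x.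
have cQ0 : rat_cone Q0.
  split; first by exists 0 => //; exact: additive_hom0.
    by move=> _ _ [x Px <-] [y Py <-]; exists (x + y); [exact: PD|exact: fD].
  by move=> _ [x Px <-]; exact: fge.
(* The order-unit [u] gives [x = n u - (n u - x)] with both terms positive. *)
have dQ0 x : diff Q0 (f x).
  have [n [_ xn]] := sP u Pu u0 x; rewrite /ple in xn.
  have PMn : P (u *+ n).
    by elim: {xn} n => [|n IH]; rewrite ?mulr0n // mulrS; apply: PD.
  exists (f (u *+ n)), (f (u *+ n - x)); split; try exact: Q0f.
  by rewrite -fB opprB addrC subrK.
have [t nQt] : exists t, ~ diff Q0 t.
  apply: contrapT => nt; apply: nGQ; exists f; split => //.
  have /choice[g gK] t : exists x, f x = t.
    have [_ [_ [[x Px <-] [y Py <-] ->]]] : diff Q0 t.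
      by apply: contrapT => Qt; apply: nt; exists t.
    by exists (x - y).
  by exists g => x; [apply: fi|]; rewrite gK.
have [p pr iQ0] := indivisible_prime cQ0 (Q0f _ Pu) fu nQt.
have [Q' [cQ' sub cons iQ']] := interpolation_envelope pr iQ0.
pose Q := Cone cQ'.
have Qu : Q (f u) by exact/sub/Q0f.
exists (diff_group Q), (@diff_cone Q); split.
- exact: diff_cone_poag.
- exact: diff_cone_simple Qu fu.
- exact: diff_cone_riesz.
- exact: diff_group_rank_one Qu fu.
have Df x : f x \in diffb Q.
  apply/asboolP; have [a [b [Qa Qb ->]]] := dQ0 x.
  by exists a, b; split => //; exact: sub.
exists (fun x => DiffGroup (Df x)); split.
- by move=> x y; apply/val_inj; rewrite raddfD /= fD.
- by move=> x y /(congr1 val) /= /fi.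
move=> y; split=> [[x [Px <-]]|[[x <-] Qx]].
  by split; [exists x|exact/sub/Q0f].
(* Conservativity makes the embedding reflect positivity. *)
by exists x; split => //; have [x' Px' /fi <-] := cons _ Qx (dQ0 x).
Qed.

Theorem theorem1p4 (G : zmodType) (P : G -> Prop) :
  is_poag P -> simple_poag P -> rank_one G -> ~ riesz P ->
  ((exists (H : zmodType) (Q : H -> Prop),
      [/\ is_poag Q, simple_poag Q, riesz Q, rank_one H &
          exists f : G -> H, order_embedding P Q f])
   <-> ~ iso_to_Q G).
Proof.
move=> oP sP rG nR; split.
  move=> [H [Q [_ _ rQ rH [f ef]]]] GQ; apply: nR.
  have [fD fi _] := ef; apply: riesz_order_iso ef _ rQ.
  exact: iso_to_Q_embedding_surj.
by have [u Pu u0] := not_riesz_neq0 oP nR; exact: riesz_envelope Pu u0.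
Qed.
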